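(* Fix $a\in(0,1/2)$ and define $\phi\colon\mathbb R\to\mathbb R$ by $$\phi(u)=\begin{cases}0,&u\le0,\\ e^{-1/u},&0<u\le a,\\ e^{-1/a}+e^{-1/a}a^{-2}(u-a),&u>a.\end{cases}$$ Let $\mathcal C=B_2(0,1)\subseteq\mathbb R^2$ be the closed Euclidean unit ball, $p=e_1=(1,0)$, and $f(x)=\phi(1-x_1)$. Let $\widehat L>0$ be any Lipschitz constant for $\phi'$, and let $(x_t)$ be the Frank--Wolfe iterates for $\min_{x\in\mathcal C}f(x)$ generated by the global short-step rule with smoothness parameter $L=\widehat L$ from $x_0=(1-u_0)e_1$, where $u_0\in(0,a)$. Then: (1) $\mathcal C$ satisfies global local dual sharpness with constants $(1/2,2)$; (2) $f$ is convex and $\widehat L$-smooth, with unique constrained minimizer $p$ over $\mathcal C$; (3) $f$ satisfies no local Hölder error bound of any finite order around its minimizer set $\{p\}$; (4) nevertheless, $$\lim_{t\to\infty}\frac{t(\log t)^4}{\widehat L}\bigl(f(x_t)-f(p)\bigr)=1 .$$ In particular, $f(x_t)-f(p)\sim\dfrac{\widehat L}{t(\log t)^4}=o(1/t)$, but $f(x_t)-f(p)$ is not $O(t^{-1-\eta})$ for any $\eta>0$.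
   Context: Norms are Euclidean. $L$-smooth: $f(y)\le f(x)+\langle\nabla f(x),y-x\rangle+\frac L2\|y-x\|^2$ for all $x,y\in\mathcal C$. LMO selector: a fixed deterministic map $S\colon\mathbb R^2\to\mathcal C$ with $S(g)\in\operatorname{argmin}_{s\in\mathcal C}\langle g,s\rangle$ for every $g$. Global local dual sharpness with constants $(A,q)$: for every $x\in\mathcal C$ and every $g\in\mathbb R^2$, $A\|g\|\,\|x-S(g)\|^q\le\langle g,x-S(g)\rangle$. Frank--Wolfe with the global short-step rule: for $t=0,1,2,\dots$ set $s_t=S(\nabla f(x_t))$, $g_t=\langle\nabla f(x_t),x_t-s_t\rangle$, $d_t=\|x_t-s_t\|$, $\gamma_t=\min\{g_t/(Ld_t^2),1\}$ (if $d_t=0$, then $x_{t+1}=x_t$ for any $\gamma_t\in[0,1]$), and $x_{t+1}=x_t+\gamma_t(s_t-x_t)$. Local Hölder error bound of order $r\ge2$ around the minimizer set $\mathcal M=\operatorname{argmin}_{\mathcal C}f$: there exist $B,\rho>0$ with $\operatorname{dist}(x,\mathcal M)^r\le B\,(f(x)-\min_{\mathcal C}f)$ for all $x\in\mathcal C$ with $\operatorname{dist}(x,\mathcal M)<\rho$. *)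

(* Defs.v *)
From HB Require Import structures.
From mathcomp Require Import all_boot all_order all_algebra.
From mathcomp Require Import all_classical all_reals all_analysis.

Set Implicit Arguments.
Unset Strict Implicit.
Unset Printing Implicit Defensive.

Import Order.TTheory GRing.Theory Num.Theory.
Import numFieldNormedType.Exports.

Local Open Scope classical_set_scope.
Local Open Scope ring_scope.

(* The library norm on ['rV[R]_n] is the sup norm (it induces the same topology
   and the same notion of differentiability), so the Euclidean one is defined
   here and used for every metric notion below. *)
Definition dot (R : realType) (n : nat) (u v : 'rV[R]_n) : R :=
  \sum_(i < n) u 0 i * v 0 i.

Definition enorm (R : realType) (n : nat) (u : 'rV[R]_n) : R :=
  Num.sqrt (dot u u).

Definition unit_ball (R : realType) (n : nat) : set 'rV[R]_n :=
  [set x | enorm x <= 1].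

Definition dist_to (R : realType) (n : nat) (x : 'rV[R]_n) (M : set 'rV[R]_n) : R :=
  inf [set enorm (x - y) | y in M].

Definition argmin (R : realType) (n : nat) (C : set 'rV[R]_n)
    (F : 'rV[R]_n -> R) : set 'rV[R]_n :=
  [set s | C s /\ forall y, C y -> F s <= F y].

Definition grad (R : realType) (n : nat) (f : 'rV[R]_n -> R) (x : 'rV[R]_n) :
    'rV[R]_n :=
  \row_(i < n) 'D_(delta_mx 0 i) f x.

(* Differentiability is required explicitly because ['D_] is a total operator. *)
Definition smooth_on (R : realType) (n : nat) (C : set 'rV[R]_n) (L : R)
    (f : 'rV[R]_n -> R) : Prop :=
  (forall x, C x -> differentiable f x) /\
  (forall x y, C x -> C y ->
     f y <= f x + dot (grad f x) (y - x) + L / 2 * enorm (y - x) ^+ 2).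

Definition lmo_selector (R : realType) (n : nat) (C : set 'rV[R]_n)
    (S : 'rV[R]_n -> 'rV[R]_n) : Prop :=
  forall g, argmin C (dot g) (S g).

Definition global_local_dual_sharpness (R : realType) (n : nat)
    (C : set 'rV[R]_n) (S : 'rV[R]_n -> 'rV[R]_n) (A q : R) : Prop :=
  forall x g, C x ->
    A * enorm g * enorm (x - S g) `^ q <= dot g (x - S g).

(* [inf (f @` C)] is the minimum of [f] over [C] whenever it is attained, that
   is, whenever [argmin C f] is nonempty. *)
Definition local_holder_error_bound (R : realType) (n : nat)
    (C : set 'rV[R]_n) (f : 'rV[R]_n -> R) (r : R) : Prop :=
  let M := argmin C f in
  exists B rho : R, [/\ 0 < B, 0 < rho &
    forall x, C x -> dist_to x M < rho ->
      dist_to x M `^ r <= B * (f x - inf (f @` C))].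

(* When [x = s] the step size below is [Num.min (0 / 0) 1 = 0], but its value
   is irrelevant: the next iterate is [x] for any step size. *)
Definition fw_step (R : realType) (n : nat) (f : 'rV[R]_n -> R)
    (S : 'rV[R]_n -> 'rV[R]_n) (L : R) (x : 'rV[R]_n) : 'rV[R]_n :=
  let s := S (grad f x) in
  let g := dot (grad f x) (x - s) in
  let d := enorm (x - s) in
  let gamma := Num.min (g / (L * d ^+ 2)) 1 in
  x + gamma *: (s - x).

Definition fw_iterates (R : realType) (n : nat) (f : 'rV[R]_n -> R)
    (S : 'rV[R]_n -> 'rV[R]_n) (L : R) (x0 : 'rV[R]_n) (t : nat) : 'rV[R]_n :=
  iter t (fw_step f S L) x0.

Definition phi (R : realType) (a u : R) : R :=
  if u <= 0 then 0
  else if u <= a then expR (- u^-1)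
  else expR (- a^-1) + expR (- a^-1) * a ^- 2 * (u - a).

Definition e1 (R : realType) : 'rV[R]_2 := delta_mx 0 0.

Definition objective (R : realType) (a : R) (x : 'rV[R]_2) : R :=
  phi a (1 - x 0 0).

(* Main.v *)
Require Import Defs.
From HB Require Import structures.
From mathcomp Require Import all_boot all_order all_algebra.
From mathcomp Require Import all_classical all_reals all_analysis.
From mathcomp Require Import ring lra.

Set Implicit Arguments.
Unset Strict Implicit.
Unset Printing Implicit Defensive.

Import Order.TTheory GRing.Theory Num.Theory.
Import numFieldNormedType.Exports.

Local Open Scope classical_set_scope.
Local Open Scope ring_scope.

(* On the segment from 0 to e1 the linear minimization oracle returns e1 and the
   short step is never clipped, so x_t = (1 - u_t) e1 with
     u_{t+1} = u_t - phi'(u_t) / L,   phi'(u) = exp(-1/u) / u^2.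
   In the variables v_t = 1/u_t and E_t = exp(v_t) / v_t^4 this recursion gives
   E_{t+1} - E_t --> 1/L, because v_{t+1} - v_t ~ v_t^4 exp(-v_t) / L.  By Cesaro
   E_t ~ t/L, hence v_t ~ ln t, and f(x_t) = exp(-v_t) = 1 / (E_t v_t^4) is
   equivalent to L / (t (ln t)^4). *)

(** * Derivatives and convexity on the line *)

(** The inequality phi'(u) < L u does double duty: it says that the short step is not clipped and
    that the next value of u stays positive. The exponent 4 in E comes from the continuous flow v' =
    v^4 exp(-v) / L, where two powers of v come from phi'(u) = v^2 exp(-v) and two from
    differentiating 1/u; along this flow exp(v) / v^4 has derivative 1/L - 4/(L v). For the discrete
    recursion the corrections are controlled by v^4 exp(-v) and 1/v, which are small only once v is
    large. So the divergence of v is needed before E can be studied, and the crude bound exp(v_t) >=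
    t/L supplies it. *)

Lemma is_derive1_epsP (R : realType) (f : R -> R) (c d : R) :
  is_derive c 1 f d <->
  forall e, 0 < e -> \forall x \near c, `|f x - f c - d * (x - c)| <= e * `|x - c|.
Proof.
split.
  move=> /is_derive1_caratheodory[g [fg cg gc]] e e0.
  move/cvgrPdist_le : cg => /(_ _ e0); apply: filterS => x gx.
  by rewrite fg -mulrBl normrM ler_wpM2r// -gc distrC.
move=> H; apply/is_derive1_caratheodory.
exists (fun z => if z == c then d else (f z - f c) / (z - c)); split.
- move=> z; case: eqVneq => [->|zc]; first by rewrite !subrr mulr0.
  by rewrite divfK// subr_eq0.
- apply/cvgrPdist_le => e e0; rewrite eqxx.
  move: (H _ e0); apply: filterS => x fx.
  case: eqVneq => [_|xc]; first by rewrite subrr normr0 ltW.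
  have xc0 : 0 < `|x - c| by rewrite normr_gt0 subr_eq0.
  by rewrite -(ler_pM2r xc0) -normrM mulrBl divfK ?subr_eq0// distrC.
- by rewrite eqxx.
Qed.

Lemma is_derive1_glue (R : realType) (f g h : R -> R) (c d : R) :
  (\forall x \near c, x <= c -> f x = g x) ->
  (\forall x \near c, c <= x -> f x = h x) ->
  is_derive c 1 g d -> is_derive c 1 h d -> is_derive c 1 f d.
Proof.
move=> fg fh /is_derive1_epsP dg /is_derive1_epsP dh; apply/is_derive1_epsP.
move=> e e0.
have fgc : f c = g c := nbhs_singleton fg (lexx c).
have fhc : f c = h c := nbhs_singleton fh (lexx c).
near=> x; have [xc|/ltW cx] := leP x c.
  rewrite fgc (near fg x)//; near: x; exact: dg.
rewrite fhc (near fh x)//; near: x; exact: dh.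
Unshelve. all: by end_near. Qed.

Lemma is_derive1_quadratic (R : realType) (f : R -> R) (c C : R) :
  (forall x, `|f x - f c| <= C * (x - c) ^+ 2) -> is_derive c 1 f 0.
Proof.
move=> H; apply/is_derive1_epsP => e e0.
have C0 : 0 <= C.
  have := H (c + 1); rewrite (_ : c + 1 - c = 1) ?expr1n ?mulr1; last by ring.
  exact: le_trans.
(* The denominator [C + 1] rather than [C] covers the case C = 0. *)
have e1 : 0 < e / (C + 1) by rewrite divr_gt0// ltr_wpDl.
near=> x.
rewrite mul0r subr0 (le_trans (H x))// -(real_normK (num_real _)) expr2 mulrA.
rewrite ler_wpM2r//.
have : `|x - c| <= e / (C + 1).
  near: x; apply: filterS (nbhsx_ballx c _ e1) => y.
  by rewrite /ball/= distrC => /ltW.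
rewrite ler_pdivlMr; last by rewrite ltr_wpDl.
by apply: le_trans; rewrite mulrC ler_wpM2l// lerDl.
Unshelve. all: by end_near. Qed.

Lemma expr_le_fact_expR (R : realType) (n : nat) (v : R) :
  0 <= v -> v ^+ n <= n`!%:R * expR v.
Proof.
move=> v0; case: n => [|n]; first by rewrite expr0 fact0 mul1r -expR0 ler_expR.
have f0 : 0 < n.+1`!%:R :> R by rewrite ltr0n fact_gt0.
rewrite -ler_pdivrMl// mulrC (le_trans _ (expR_ge1Dxn n v0))//.
by rewrite lerDr.
Qed.

(** Flatness of exp(-1/u) at 0 in quantitative form. The exponent 2 gives differentiability of [phi]
    at 0, 4 the unclipped step, 5 the decay of the increments of 1/u, and arbitrary exponents the
    failure of error bounds. *)
Lemma expRNV_le_expr (R : realType) (n : nat) (u : R) :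
  0 < u -> expR (- u^-1) <= n`!%:R * u ^+ n.
Proof.
move=> u0; have vu : 0 <= u^-1 by rewrite invr_ge0 ltW.
have := expr_le_fact_expR n vu.
rewrite exprVn expRN => H.
rewrite -[leLHS]mul1r ler_pdivrMr ?expR_gt0// mulrAC.
by rewrite -ler_pdivrMr ?exprn_gt0// div1r.
Qed.

(** * The derivative of phi and its monotonicity *)

Definition dphi (R : realType) (a u : R) : R :=
  if u <= 0 then 0
  else if u <= a then expR (- u^-1) * u ^- 2
  else expR (- a^-1) * a ^- 2.

Lemma is_derive_expRNV (R : realType) (u : R) : 0 < u ->
  is_derive u 1 (fun x => expR (- x^-1)) (expR (- u^-1) * u ^- 2).
Proof.
move=> u0.
have d1 : is_derive u 1 (fun x : R => - x^-1) (u ^- 2).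
  have := is_deriveN (@is_deriveV _ id u 1 1 (lt0r_neq0 u0) (is_derive_id _ _)).
  by rewrite scaleNr opprK [_ *: _]mulr1.
exact: (is_derive1_comp (is_derive_expR _) d1).
Qed.

(** Away from 0 and [a] a single formula holds locally. At [a] the affine piece is the tangent of
    exp(-1/u), so both one-sided formulas have the same slope and can be glued; at 0 the bound
    exp(-1/u) <= 2 u^2 gives slope 0. *)
Lemma is_derive_phi (R : realType) (a u : R) : 0 < a ->
  is_derive u 1 (phi a) (dphi a u).
Proof.
move=> a0; rewrite /dphi; case: (ltgtP u 0) => [u0|u0|->].
- apply: (@near_eq_is_derive _ _ _ (cst (0 : R))).
  near=> x; rewrite /phi ltW//.
  by near: x; exact: lt_nbhsl.
- case: (ltgtP u a) => [ua|ua|->].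
  + apply: near_eq_is_derive (is_derive_expRNV u0).
    near=> x; have x0 : 0 < x by near: x; exact: lt_nbhsr.
    have xa : x < a by near: x; exact: lt_nbhsl.
    by rewrite /phi (leNgt x) x0/= ltW.
  + have d : is_derive u 1 (fun x : R => expR (- a^-1) + expR (- a^-1) * a ^- 2 * (x - a))
        (expR (- a^-1) * a ^- 2).
      apply/is_derive1_epsP => e e0; near=> x.
      rewrite (_ : _ - _ = 0) ?normr0 ?mulr_ge0 ?(ltW e0)//; ring.
    apply: near_eq_is_derive d.
    near=> x; have xa : a < x by near: x; exact: lt_nbhsr.
    by rewrite /phi !leNgt xa (lt_trans a0 xa).
  + apply: (is_derive1_glue (g := fun x => expR (- x^-1))
      (h := fun x : R => expR (- a^-1) + expR (- a^-1) * a ^- 2 * (x - a))).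
    * near=> x; have x0 : 0 < x by near: x; exact: lt_nbhsr.
      by move=> xa; rewrite /phi (leNgt x) x0/= xa.
    * near=> x; have x0 : 0 < x by near: x; exact: lt_nbhsr.
      rewrite /phi (leNgt x 0) x0/= => ax; case: ltgtP ax => // -> _.
      by rewrite subrr mulr0 addr0.
    * exact: is_derive_expRNV.
    * apply/is_derive1_epsP => e e0; near=> x.
      rewrite (_ : _ - _ = 0) ?normr0 ?mulr_ge0 ?(ltW e0)//; ring.
- pose psi (x : R) : R := if x <= 0 then 0 else expR (- x^-1).
  apply: (@near_eq_is_derive _ _ _ psi).
    near=> x; have xa : x < a by near: x; exact: lt_nbhsl.
    by rewrite /psi /phi (ltW xa).
  apply: (@is_derive1_quadratic _ _ _ 2) => x; rewrite /psi lexx !subr0.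
  case: (leP x 0) => x0; first by rewrite normr0 mulr_ge0// sqr_ge0.
  rewrite ger0_norm ?expR_ge0//; exact: (expRNV_le_expr 2 x0).
Unshelve. all: by end_near. Qed.

Lemma derive1_phi (R : realType) (a : R) : 0 < a ->
  ((phi a)^`())%classic = dphi a.
Proof.
move=> a0; apply/funext => u; rewrite derive1E.
by have [_] := is_derive_phi u a0.
Qed.

(* In the variable [v = 1/u] the claim is that [v^2 exp(-v)] decreases on [v >= 2]. *)
Lemma expRNV_sqr_le (R : realType) (u w : R) : 0 < u -> u <= w -> w <= 1 / 2 ->
  expR (- u^-1) * u ^- 2 <= expR (- w^-1) * w ^- 2.
Proof.
move=> u0 uw w2; have w0 : 0 < w := lt_le_trans u0 uw.
set s := u^-1; set t := w^-1.
have s0 : 0 < s by rewrite invr_gt0.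
have t0 : 0 < t by rewrite invr_gt0.
have ts : t <= s by rewrite lef_pV2// posrE.
have t2 : 2 <= t by rewrite /t -[2]invrK lef_pV2 ?posrE// -div1r.
rewrite -!exprVn -/s -/t.
(* This is the square root of the claim. The linear bound on the exponential suffices because t >= 2
   gives s = t + (s - t) <= t + t (s - t) / 2. *)
have h : s <= t * expR ((s - t) / 2).
  apply: le_trans (_ : t * (1 + (s - t) / 2) <= _); last first.
    by rewrite ler_wpM2l ?(ltW t0)// expR_ge1Dx.
  by nra.
have -> : expR (- s) * s ^+ 2 <= expR (- t) * t ^+ 2
          = (s ^+ 2 <= (t * expR ((s - t) / 2)) ^+ 2).
  rewrite -[LHS](@ler_pM2l _ (expR s)) ?expR_gt0// !mulrA expRxMexpNx_1 mul1r.
  rewrite -expRD exprMn [_ ^+ 2 in RHS]expr2 [expR _ ^+ 2]expr2 -expRD.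
  by rewrite -splitr [RHS]/(_ <= t * t * _) [t * t * _]mulrC mulrA.
by rewrite ler_sqr ?nnegrE ?(ltW s0)// mulr_ge0 ?expR_ge0 ?(ltW t0).
Qed.

Lemma dphi_ge0 (R : realType) (a u : R) : 0 <= dphi a u.
Proof.
rewrite /dphi; case: ifP => // _.
by case: ifP => _; rewrite mulr_ge0 ?expR_ge0// invr_ge0 sqr_ge0.
Qed.

(** The bound a < 1/2 enters here: exp(-1/u) / u^2 increases only up to u = 1/2, and beyond [a] the
    slope is frozen. *)
Lemma dphi_nondecreasing (R : realType) (a : R) : 0 < a < 1 / 2 ->
  {homo dphi a : u w / u <= w}.
Proof.
move=> /andP[a0 a2] u w uw; rewrite {1}/dphi.
case: (leP u 0) => u0; first exact: dphi_ge0.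
rewrite /dphi (leNgt w 0) (lt_le_trans u0 uw)/=.
case: (leP w a) => wa.
  by rewrite (le_trans uw wa) expRNV_sqr_le// (le_trans wa)// ltW.
by case: (leP u a) => // ua; rewrite expRNV_sqr_le// ltW.
Qed.

Lemma tangent_le (R : realType) (f df : R -> R) (u w : R) :
  (forall x : R, is_derive x 1 f (df x)) -> {homo df : x y / x <= y} ->
  f u + df u * (w - u) <= f w.
Proof.
move=> fd dfh.
have cf x y : {within `[x, y], continuous f}.
  apply/continuous_subspaceT => z.
  exact/differentiable_continuous/derivable1_diffP.
rewrite -lerBrDl; case: (leP u w) => uw.
  have [c] := MVT_segment uw (fun x _ => fd x) (cf _ _).
  rewrite in_itv/= => /andP[uc _] ->.
  by rewrite ler_wpM2r ?subr_ge0// dfh.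
have [c] := MVT_segment (ltW uw) (fun x _ => fd x) (cf _ _).
rewrite in_itv/= => /andP[_ cu] /eqP; rewrite -eqr_opp opprB -mulrN opprB => /eqP ->.
by rewrite ler_wnM2r ?subr_le0 ?(ltW uw)// dfh.
Qed.

(* The convex function [L/2 x^2 - f x] lies above its tangent at [u]. *)
Lemma descent_lemma (R : realType) (f df : R -> R) (L u w : R) :
  (forall x : R, is_derive x 1 f (df x)) ->
  (forall x y, x <= y -> df y - df x <= L * (y - x)) ->
  f w <= f u + df u * (w - u) + L / 2 * (w - u) ^+ 2.
Proof.
move=> fd dfL.
pose g x := L / 2 * x ^+ 2 - f x.
have gd (x : R) : is_derive x 1 g (L * x - df x).
  have dX : is_derive x 1 (fun y : R => L / 2 * y ^+ 2) (L * x).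
    have d : is_derive x 1 (fun y : R => L / 2 * y ^+ 2)
        (L / 2 *: ((2%:R * x ^+ 1) *: 1)).
      have dX := @is_deriveX _ _ id 2 x 1 1 (is_derive_id _ _).
      have dZ := is_deriveZ (L / 2) dX.
      exact: dZ.
    by apply: is_derive_eq; rewrite [_ *: 1]mulr1 /GRing.scale/=; field.
  exact: is_deriveB.
have gh : {homo (fun x => L * x - df x) : x y / x <= y}.
  by move=> x y /dfL; lra.
have := tangent_le u w gd gh; rewrite /g => H.
move: H; rewrite -subr_ge0 => H; rewrite -subr_ge0.
by apply: le_trans H _; rewrite le_eqVlt; apply/orP; left; apply/eqP; field.
Qed.

(** * Euclidean space *)

Section Euclidean.
Variables (R : realType) (n : nat).
Implicit Types (u v w : 'rV[R]_n) (k : R).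

Lemma dotC u v : dot u v = dot v u.
Proof. by apply: eq_bigr => i _; rewrite mulrC. Qed.

Lemma dotDl u v w : dot (u + v) w = dot u w + dot v w.
Proof. by rewrite -big_split; apply: eq_bigr => i _; rewrite mxE mulrDl. Qed.

Lemma dotZl k u v : dot (k *: u) v = k * dot u v.
Proof. by rewrite /dot mulr_sumr; apply: eq_bigr => i _; rewrite mxE mulrA. Qed.

Lemma dotDr u v w : dot w (u + v) = dot w u + dot w v.
Proof. by rewrite !(dotC w) dotDl. Qed.

Lemma dotZr k u v : dot v (k *: u) = k * dot v u.
Proof. by rewrite !(dotC v) dotZl. Qed.

Lemma dotNl u v : dot (- u) v = - dot u v.
Proof. by rewrite -scaleN1r dotZl mulN1r. Qed.

Lemma dotNr u v : dot v (- u) = - dot v u.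
Proof. by rewrite !(dotC v) dotNl. Qed.

Lemma dotvv_ge0 u : 0 <= dot u u.
Proof. by apply: sumr_ge0 => i _; rewrite -expr2 sqr_ge0. Qed.

Lemma coord_sqr_le_dot u i : u 0 i ^+ 2 <= dot u u.
Proof.
rewrite /dot (bigD1 i)//= -expr2 lerDl.
by apply: sumr_ge0 => j _; rewrite -expr2 sqr_ge0.
Qed.

Lemma dotvv_eq0 u : dot u u = 0 -> u = 0.
Proof.
move=> u0; apply/rowP => i; rewrite mxE; apply/eqP.
by rewrite -sqrf_eq0 eq_le sqr_ge0 andbT -u0 coord_sqr_le_dot.
Qed.

Lemma enorm_sqr u : enorm u ^+ 2 = dot u u.
Proof. by rewrite sqr_sqrtr// dotvv_ge0. Qed.

Lemma enorm_ge0 u : 0 <= enorm u.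
Proof. exact: sqrtr_ge0. Qed.

Lemma enormZ k u : enorm (k *: u) = `|k| * enorm u.
Proof.
by rewrite /enorm dotZl dotZr mulrA -expr2 sqrtrM ?sqr_ge0// sqrtr_sqr.
Qed.

Lemma unit_ballE u : unit_ball u = (dot u u <= 1) :> Prop.
Proof.
rewrite /unit_ball /= -enorm_sqr; congr is_true.
by rewrite -(expr1n R 2) ler_sqr ?nnegrE ?enorm_ge0// expr1n.
Qed.

(* If [s] minimizes [<g, .>] over the ball then [<g, s> <= -|g|], whence
   [|g + |g| s|^2 <= |g|^2 - 2 |g|^2 + |g|^2 = 0]. *)
Lemma lmo_unit_ball S u : lmo_selector (@unit_ball R n) S ->
  enorm u *: S u = - u.
Proof.
move=> /(_ u) [/= Su minS].
have [->|u0] := eqVneq u 0.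
  rewrite oppr0 (_ : enorm _ = 0) ?scale0r//; apply/eqP; rewrite -sqrf_eq0.
  by rewrite enorm_sqr -(scale0r (0 : 'rV[R]_n)) dotZl mul0r.
have e0 : 0 < enorm u.
  rewrite lt_neqAle enorm_ge0 andbT eq_sym; apply: contra_neq u0 => e0.
  by apply: dotvv_eq0; rewrite -enorm_sqr e0 expr0n.
have /minS : unit_ball (- (enorm u)^-1 *: u).
  by rewrite /unit_ball/= enormZ normrN ger0_norm ?invr_ge0 ?enorm_ge0// mulVf ?gt_eqF.
rewrite dotZr -enorm_sqr mulNr expr2 mulKf ?gt_eqF// => us.
move: Su; rewrite -/(unit_ball _) unit_ballE => Su.
apply/eqP; rewrite -addr_eq0; apply/eqP/dotvv_eq0.
apply/eqP; rewrite eq_le dotvv_ge0 andbT.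
rewrite !(dotDl, dotDr, dotZl, dotZr) (dotC (S u) u) -(enorm_sqr u).
set d := dot u (S u) in us *; set c := dot _ _ in Su *; set e := enorm u in e0 us *.
have : e * (e * c) <= e * e by rewrite ler_pM2l// -[leRHS]mulr1 ler_pM2l.
have : e * d <= - (e * e) by rewrite -mulrN ler_pM2l.
lra.
Qed.

(** For g != 0 the oracle returns the unit vector s = -g/|g|, so the gap is |g| (1 - <s, x>), while
    |x - s|^2 = |x|^2 + 1 - 2 <s, x> is at most 2 (1 - <s, x>). *)
Lemma unit_ball_sharpness S : lmo_selector (@unit_ball R n) S ->
  global_local_dual_sharpness (@unit_ball R n) S (1 / 2) 2.
Proof.
move=> HS x g; rewrite unit_ballE => x1.
rewrite (powR_mulrn 2) ?enorm_ge0// enorm_sqr.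
have Sg := lmo_unit_ball g HS.
have -> : dot g (x - S g) = enorm g * dot (- S g) (x - S g).
  by rewrite -dotZl scalerN Sg opprK.
rewrite [1 / 2 * _]mulrC -mulrA.
have [g0|g0] := eqVneq (enorm g) 0; first by rewrite g0 !mul0r.
rewrite ler_wpM2l ?enorm_ge0//.
have Sg1 : dot (S g) (S g) = 1.
  have : dot (enorm g *: S g) (enorm g *: S g) = dot (- g) (- g) by rewrite Sg.
  rewrite dotNl dotNr opprK dotZl dotZr mulrA -expr2 -(enorm_sqr g).
  by rewrite -[RHS]mulr1 => /mulfI; apply; rewrite sqrf_eq0.
rewrite !(dotDl, dotDr, dotNl, dotNr) Sg1 (dotC x (S g)).
lra.
Qed.

End Euclidean.

(** * Functions of a single coordinate *)

Section Ridge.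
Variables (R : realType) (n : nat) (h dh : R -> R) (i : 'I_n).
Hypothesis hd : forall x : R, is_derive x 1 h (dh x).
Implicit Types x y : 'rV[R]_n.

Let f x := h (1 - x 0 i).

Lemma differentiable_ridge x : differentiable f x.
Proof.
apply: (@differentiable_comp _ _ _ _ (fun y : 'rV[R]_n => 1 - y 0 i : R) h).
  by apply: differentiableB => //; exact: differentiable_coord.
by apply/derivable1_diffP; have [] := hd (1 - x 0 i).
Qed.

Lemma grad_ridge x : grad f x = - dh (1 - x 0 i) *: delta_mx 0 i.
Proof.
apply/rowP => j; rewrite !mxE/=; set c := ((j == i)%:R : R).
(* [l] is the argument of [h] along the line through x in direction e_j, so the partial derivative
   is that of [h] after [l] at 0; the slope -c vanishes unless j = i. *)
pose l (t : R) : R := 1 - (t * c + x 0 i).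
have dl : is_derive (0 : R) 1 l (- c).
  apply/is_derive1_epsP => e e0; near=> t.
  by rewrite (_ : _ - _ = 0) ?normr0 ?mulr_ge0 ?(ltW e0)// /l; ring.
have hl0 : is_derive (l 0) 1 h (dh (l 0)) by exact: hd.
have [_] := is_derive1_comp hl0 dl.
rewrite {2}/l mul0r add0r mulrN -mulNr => <-.
rewrite /derive.
apply: (congr1 (fun q : R -> R => lim (q t @[t --> 0^']))); apply/funext => t /=.
by rewrite /f /l !mxE/= eq_sym addr0 mul0r add0r [_ *: 1]mulr1.
Unshelve. all: by end_near. Qed.

Lemma smooth_on_ridge (C : set 'rV[R]_n) (L : R) : 0 <= L ->
  (forall u w, u <= w -> dh w - dh u <= L * (w - u)) -> smooth_on C L f.
Proof.
move=> L0 dhL; split=> [x _|x y _ _]; first exact: differentiable_ridge.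
have -> : dot (grad f x) (y - x) = dh (1 - x 0 i) * ((1 - y 0 i) - (1 - x 0 i)).
  rewrite grad_ridge dotZl /dot (bigD1 i)//= big1 ?addr0.
    by rewrite !mxE !eqxx mul1r mulNr -mulrN; congr (_ * _); ring.
  by move=> j ji; rewrite !mxE eqxx (negbTE ji) mul0r.
apply: le_trans (descent_lemma (1 - x 0 i) (1 - y 0 i) hd dhL) _.
rewrite lerD2l ler_wpM2l ?divr_ge0// enorm_sqr.
rewrite (_ : 1 - y 0 i - _ = - (y - x) 0 i); last by rewrite !mxE; ring.
by rewrite sqrrN coord_sqr_le_dot.
Qed.

Lemma convex_ridge : {homo dh : u w / u <= w} -> convex_function setT f.
Proof.
move=> dhh t x y _ _.
set p := t%:num; have p0 : 0 <= p by rewrite /p ge0.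
have p1 : 0 <= 1 - p by rewrite subr_ge0 /p le1.
rewrite /f; set u := 1 - x 0 i; set w := 1 - y 0 i.
have -> : 1 - (conv t x y : 'rV[R]_n) 0 i = p * u + (1 - p) * w.
  by rewrite !mxE /u /w /p /= /unstable.onem; ring.
set z := p * u + _.
(* Both tangents are taken at the convex combination z, so their weighted linear terms cancel. *)
have hu := tangent_le z u hd dhh; have hw := tangent_le z w hd dhh.
apply: le_trans (_ : p * h u + (1 - p) * h w <= _); last by [].
have := lerD (ler_wpM2l p0 hu) (ler_wpM2l p1 hw); apply: le_trans.
by rewrite le_eqVlt; apply/orP; left; apply/eqP; rewrite /z; ring.
Qed.

End Ridge.

(** * The objective *)

Section Phi.
Variables (R : realType) (a : R).

Lemma phi0 : phi a 0 = 0.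
Proof. by rewrite /phi lexx. Qed.

Lemma phiE u : 0 < u <= a -> phi a u = expR (- u^-1).
Proof. by move=> /andP[u0 ua]; rewrite /phi leNgt u0/= ua. Qed.

Lemma phi_gt0 u : 0 < u -> 0 < phi a u.
Proof.
move=> u0; rewrite /phi leNgt u0/=; case: (leP u a) => ua; first exact: expR_gt0.
by rewrite ltr_wpDr ?expR_gt0// !mulr_ge0 ?expR_ge0 ?invr_ge0 ?sqr_ge0// subr_ge0 ltW.
Qed.

Lemma phi_ge0 u : 0 <= phi a u.
Proof.
by have [u0|/phi_gt0/ltW//] := leP u 0; rewrite /phi u0.
Qed.

Lemma dphiE u : 0 < u <= a -> dphi a u = expR (- u^-1) * u ^- 2.
Proof. by move=> /andP[u0 ua]; rewrite /dphi leNgt u0/= ua. Qed.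

Lemma dphi_lipschitz_le (L u w : R) : L.-lipschitz (dphi a) -> u <= w ->
  dphi a w - dphi a u <= L * (w - u).
Proof.
move=> /(_ (w, u)) /= lip uw; apply: le_trans (ler_norm _) _.
by rewrite -(ger0_norm (_ : 0 <= w - u)) ?subr_ge0//; exact: lip.
Qed.

(* [dphi u >= L u] would force [dphi v >= L v] on [0, u], but [dphi v = O(v^2)]. *)
Lemma dphi_lt_linear (L u : R) : 0 < L -> L.-lipschitz (dphi a) ->
  0 < u <= a -> dphi a u < L * u.
Proof.
move=> L0 lip /andP[u0 ua]; rewrite ltNge; apply/negP => Lu.
(* Here 48 is twice 4! = 24: v <= L/48 gives 24 v^2 <= L v / 2, against the inequality L v <=
   [dphi a v] <= 24 v^2 forced by the Lipschitz bound. *)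
pose v := Num.min u (L / 48).
have v0 : 0 < v by rewrite lt_min u0 divr_gt0.
have vu : v <= u by rewrite ge_min lexx.
have vL : v <= L / 48 by rewrite ge_min lexx orbT.
have := dphi_lipschitz_le lip vu.
have Lv : dphi a v <= 24 * v ^+ 2.
  rewrite dphiE ?v0 ?(le_trans vu)// ler_pdivrMr ?exprn_gt0// -mulrA -exprD.
  exact: (expRNV_le_expr 4 v0).
have : v * (L - 24 * v) > 0 by rewrite mulr_gt0//; lra.
by lra.
Qed.

End Phi.

Section Objective.
Variables (R : realType) (a : R).
Hypothesis a0 : 0 < a.

Lemma objective_e1 k : objective a (k *: e1 R) = phi a (1 - k).
Proof. by rewrite /objective !mxE mulr1. Qed.

Lemma unit_ball_coord_le1 (x : 'rV[R]_2) : unit_ball x -> x 0 0 <= 1.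
Proof.
rewrite unit_ballE => x1; rewrite leNgt; apply/negP => x0.
have := le_trans (coord_sqr_le_dot x 0) x1; apply/negP; rewrite -ltNge.
by rewrite expr2; nra.
Qed.

Lemma enorm_e1 : enorm (e1 R) = 1.
Proof.
by rewrite /enorm /dot !big_ord_recl big_ord0 !mxE/= mulr0 !addr0 mulr1 sqrtr1.
Qed.

Lemma unit_ball_e1 k : 0 <= k <= 1 -> unit_ball (k *: e1 R).
Proof.
move=> /andP[k0 k1]; rewrite /unit_ball/= enormZ enorm_e1 mulr1.
by rewrite ger0_norm.
Qed.

(** A minimizer has value 0, hence first coordinate at least 1, and in the ball this forces |x -
    e1|^2 = |x|^2 - 2 x_1 + 1 <= 0. *)
Lemma argmin_objective : argmin (@unit_ball R 2) (objective a) = [set e1 R].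
Proof.
have e1B : unit_ball (e1 R).
  by rewrite -[e1 R]scale1r; apply: unit_ball_e1; rewrite ler01 lexx.
have fe1 : objective a (e1 R) = 0 by rewrite -[e1 R]scale1r objective_e1 subrr phi0.
apply/seteqP; split=> [x [xB /(_ _ e1B)]|x ->]; last first.
  by split=> // y _; rewrite fe1 phi_ge0.
rewrite fe1 /objective => fx; apply/eqP; rewrite -subr_eq0; apply/eqP/dotvv_eq0.
have x1 : 1 <= x 0 0.
  by rewrite leNgt; apply/negP; rewrite -subr_gt0 => /(phi_gt0 a); rewrite ltNge fx.
have x00 : x 0 0 = 1 by apply/le_anti; rewrite x1 unit_ball_coord_le1.
have e1x : dot (e1 R) x = 1.
  by rewrite /dot !big_ord_recl big_ord0 !mxE/= mul1r mul0r !addr0.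
rewrite !(dotDl, dotDr, dotNl, dotNr) (dotC x) e1x -(enorm_sqr (e1 R)) enorm_e1 expr1n.
have : dot x x <= 1 by rewrite -unit_ballE.
have := coord_sqr_le_dot x 0; rewrite x00 expr1n => h1 h2.
by apply/eqP; rewrite eq_le; apply/andP; split; lra.
Qed.

Lemma inf_objective : inf (objective a @` @unit_ball R 2) = 0.
Proof.
have [e1B e1min] : argmin (@unit_ball R 2) (objective a) (e1 R).
  by rewrite argmin_objective.
have fe1 : objective a (e1 R) = 0 by rewrite -[e1 R]scale1r objective_e1 subrr phi0.
apply/le_anti/andP; split.
  apply: ge_inf; last by exists (e1 R).
  by exists 0 => _ [y _ <-]; exact: phi_ge0.
apply: lb_le_inf; first by exists 0, (e1 R).
by move=> _ [y _ <-]; exact: phi_ge0.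
Qed.

(** On the segment towards e1 the distance is u and the gap exp(-1/u). With a natural n >= r, the
    flatness bound of exponent n+1 leaves a spare factor u that defeats any constant [B]. *)
Lemma no_local_holder_error_bound (r : R) : 0 <= r ->
  ~ local_holder_error_bound (@unit_ball R 2) (objective a) r.
Proof.
move=> r0 [B [rho [B0 rho0]]]; rewrite argmin_objective inf_objective => H.
have [n rn] : exists n : nat, r <= n%:R.
  by exists (Num.truncn r).+1; rewrite ltW// truncnS_gt.
(* The caps give, in turn, u^n <= u^r together with a point of the ball, the exponential branch of
   [phi], a point within [rho], and B (n+1)! u <= 1/2, which contradicts the bound 1 <= B (n+1)! u
   obtained below. *)
pose u := Num.min (Num.min 1 a) (Num.min (rho / 2) (2 * B * n.+1`!%:R)^-1).
have C0 : 0 < B * n.+1`!%:R by rewrite mulr_gt0// ltr0n fact_gt0.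
have u0 : 0 < u.
  by rewrite !lt_min ltr01 a0 divr_gt0//= invr_gt0 -mulrA mulr_gt0.
have u1 : u <= 1 by rewrite !ge_min lexx.
have ua : u <= a by rewrite !ge_min lexx orbT.
have urho : u < rho.
  apply: (@le_lt_trans _ _ (rho / 2)); first by rewrite !ge_min lexx !orbT.
  by rewrite ltr_pdivrMr//; lra.
have uC : u <= (2 * B * n.+1`!%:R)^-1 by rewrite !ge_min lexx !orbT.
have xB : unit_ball ((1 - u) *: e1 R) by apply: unit_ball_e1; lra.
have dx : dist_to ((1 - u) *: e1 R) [set e1 R] = u.
  rewrite /dist_to image_set1 inf1 -[X in _ - X]scale1r -scalerBl.
  by rewrite enormZ enorm_e1 mulr1 addrAC subrr add0r normrN gtr0_norm.
have := H _ xB; rewrite dx => /(_ urho); rewrite objective_e1 subr0 subKr.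
rewrite phiE ?u0// => Hu.
have ur : u ^+ n <= u `^ r.
  by rewrite -powR_mulrn ?(ltW u0)// ger_powR// u0 u1.
have := le_trans ur (le_trans Hu (ler_wpM2l (ltW B0) (expRNV_le_expr n.+1 u0))).
rewrite exprS mulrCA mulrA [u * _]mulrC mulrA.
rewrite -mulrA [_ ^+ n * u]mulrC mulrA -[X in X <= _ -> _]mul1r.
rewrite -subr_ge0 -mulrBl pmulr_lge0 ?exprn_gt0// subr_ge0 [_ * B]mulrC => h.
have := le_trans h (ler_wpM2l (ltW C0) uC).
rewrite -mulrA invfM mulrCA divff ?gt_eqF// mulr1.
by lra.
Qed.

End Objective.

(** * Asymptotics of the recursion *)

Lemma cvg_near_eq (R : realType) (f g : nat -> R) (l : R) :
  (\forall t \near \oo, f t = g t) -> f t @[t --> \oo] --> l ->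
  g t @[t --> \oo] --> l.
Proof.
move=> fg fl; apply: cvg_trans fl; apply: near_eq_cvg.
by apply: filterS fg => t ->.
Qed.

Section Rate.
Variables (R : realType) (L : R) (u : nat -> R).
Hypothesis L0 : 0 < L.
Hypothesis u_gt0 : forall t, 0 < u t.
Hypothesis u_le1 : forall t, u t <= 1.
Hypothesis uS : forall t, u t.+1 = u t - expR (- (u t)^-1) * (u t) ^- 2 / L.

Let v t := (u t)^-1.
(* Relative decrease of [u], so that [v t.+1 = v t + d t]. *)
Let k t := expR (- v t) * v t ^+ 3 / L.
Let d t := v t * k t / (1 - k t).
Let E t := expR (v t) / v t ^+ 4.

Let v_gt0 t : 0 < v t. Proof. by rewrite invr_gt0. Qed.

Let v_neq0 t : v t != 0. Proof. exact: lt0r_neq0. Qed.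

Let v_ge1 t : 1 <= v t.
Proof. by rewrite -invr1 lef_pV2 ?posrE. Qed.

Let k_ge0 t : 0 <= k t.
Proof. by rewrite !mulr_ge0 ?expR_ge0 ?exprn_ge0 ?invr_ge0 ?(ltW (v_gt0 _)) ?ltW. Qed.

Let uSk t : u t.+1 = u t * (1 - k t).
Proof.
rewrite uS /k /v; have := u_gt0 t => /lt0r_neq0 ut; move: (lt0r_neq0 L0) => Ln.
by field; rewrite ut Ln.
Qed.

Let k_lt1 t : k t < 1.
Proof. by have := u_gt0 t.+1; rewrite uSk pmulr_rgt0 ?subr_gt0. Qed.

Let vSk t : v t.+1 = v t / (1 - k t).
Proof. by rewrite /v uSk invfM. Qed.

Let k1n t : 1 - k t != 0.
Proof. by rewrite gt_eqF// subr_gt0. Qed.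

Let vS t : v t.+1 = v t + d t.
Proof. by rewrite vSk /d; field. Qed.

Let d_ge0 t : 0 <= d t.
Proof. by rewrite divr_ge0 ?subr_ge0 ?(ltW (k_lt1 t))// mulr_ge0 ?(ltW (v_gt0 t)). Qed.

Let E_gt0 t : 0 < E t.
Proof. by rewrite divr_gt0 ?expR_gt0 ?exprn_gt0. Qed.

Let Ek t : E t * k t = (L * v t)^-1.
Proof.
rewrite /E /k expRN; have := v_neq0 t => vt; move: (lt0r_neq0 L0) => Ln.
by field; rewrite vt Ln (gt_eqF (expR_gt0 _)).
Qed.

(** Exponential and powers of v cancel exactly, so E d differs from 1/L only by the factor 1/(1 -
    k). *)
Let Ed t : E t * d t = (L * (1 - k t))^-1.
Proof.
rewrite /d mulrA [v t * _]mulrC mulrA Ek.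
have := v_neq0 t => vt; move: (lt0r_neq0 L0) => Ln.
by field; rewrite vt Ln k1n.
Qed.

(** Each step adds at least exp(v) d = v^4 / (L (1 - k)) to exp(v), and this is at least 1/L because
    v >= 1 and 0 < 1 - k <= 1. *)
Let expR_v_lb t : t%:R / L <= expR (v t).
Proof.
elim: t => [|t IH]; first by rewrite mul0r expR_ge0.
have : expR (v t) * (1 + d t) <= expR (v t.+1).
  by rewrite vS expRD ler_wpM2l ?expR_ge0// expR_ge1Dx.
apply: le_trans; rewrite mulrDr mulr1 -natr1 mulrDl lerD// div1r.
have -> : expR (v t) * d t = v t ^+ 4 * (E t * d t).
  by rewrite /E; field; rewrite v_neq0.
rewrite Ed invfM mulrCA -[leLHS]mulr1 ler_wpM2l ?invr_ge0 ?(ltW L0)//.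
rewrite -[leLHS]mulr1 ler_pM//; first by rewrite exprn_ege1.
by rewrite -[leLHS]invr1 lef_pV2 ?posrE ?subr_gt0// lerBlDr lerDl.
Qed.

Let u_cvg0 : u t @[t --> \oo] --> 0.
Proof.
apply/cvgrPdist_le => e e0; near=> t.
rewrite sub0r normrN gtr0_norm// -[u t]invrK -[e]invrK lef_pV2 ?posrE ?invr_gt0//.
rewrite -ler_expR (le_trans _ (expR_v_lb t))// ler_pdivlMr//.
by near: t; exact: nbhs_infty_ger.
Unshelve. all: by end_near. Qed.

(** The factor v is kept because d = v k / (1 - k). Since v k = v^4 exp(-v) / L, the flatness bound
    of exponent 5 leaves one power of u. *)
Let vk_cvg0 : v t * k t @[t --> \oo] --> 0.
Proof.
have ub : 5`!%:R / L * u t @[t --> \oo] --> 0.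
  by rewrite -[X in _ --> X](mulr0 (5`!%:R / L)); apply: cvgM => //; exact: cvg_cst.
apply: (squeeze_cvgr _ (cvg_cst 0) ub); near=> t.
rewrite mulr_ge0 ?(ltW (v_gt0 t))//= mulrC /k.
rewrite mulrAC [leRHS]mulrAC ler_wpM2r ?invr_ge0 ?(ltW L0)//.
have := ler_wpM2r (exprn_ge0 4 (ltW (v_gt0 t))) (expRNV_le_expr 5 (u_gt0 t)).
rewrite -/(v t) [_ ^+ 4 in X in X -> _]exprSr mulrA => /le_trans; apply.
by rewrite /v le_eqVlt; apply/orP; left; apply/eqP; field; rewrite lt0r_neq0.
Unshelve. all: by end_near. Qed.

Let k_cvg0 : k t @[t --> \oo] --> 0.
Proof.
apply: (squeeze_cvgr _ (cvg_cst 0) vk_cvg0); near=> t.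
by rewrite k_ge0 ler_peMl.
Unshelve. all: by end_near. Qed.

Let k1_cvg : 1 - k t @[t --> \oo] --> (1 : R).
Proof. by rewrite -[X in _ --> X]subr0; apply: cvgB => //; exact: cvg_cst. Qed.

Let d_cvg0 : d t @[t --> \oo] --> 0.
Proof.
rewrite -[X in _ --> X](mul0r (1^-1)); apply: cvgM => //.
by apply: cvgV => //; exact: oner_neq0.
Qed.

(** The growth of v^4 in the denominator is dropped and exp(d) <= 1/(1 - d), so the increment is at
    most E d / (1 - d). *)
Let Ediff_le t : d t < 1 -> E t.+1 - E t <= (L * (1 - k t))^-1 / (1 - d t).
Proof.
move=> d1; rewrite -Ed.
have d1' : 0 < 1 - d t by rewrite subr_gt0.
have ed : expR (d t) <= (1 - d t)^-1.
  by rewrite -[expR _]invrK -expRN lef_pV2 ?posrE ?expR_gt0// expR_ge1Dx.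
have : E t.+1 <= E t / (1 - d t).
  rewrite /E mulrAC ler_pM ?expR_ge0 ?invr_ge0 ?exprn_ge0 ?(ltW (v_gt0 _))//.
    by rewrite vS expRD ler_wpM2l ?expR_ge0.
  rewrite lef_pV2 ?posrE ?exprn_gt0// lerXn2r ?nnegrE ?(ltW (v_gt0 _))//.
  by rewrite vS lerDl d_ge0.
have -> : E t * d t / (1 - d t) = E t / (1 - d t) - E t by field; rewrite gt_eqF.
by rewrite lerD2r.
Qed.

(** Since v is divided by 1 - k, the next E is exactly E exp(d) (1 - k)^4. The bounds exp(d) >= 1 +
    d and (1 - k)^4 >= 1 - 4 k leave (1 - 4 k) E d - 4 E k. *)
Let Ediff_ge t : (1 - 4 * k t) * (L * (1 - k t))^-1 - 4 * (L * v t)^-1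
  <= E t.+1 - E t.
Proof.
rewrite -Ed -Ek.
have : E t * ((1 + d t) * (1 - k t) ^+ 4) <= E t.+1.
  have -> : E t.+1 = E t * (expR (d t) * (1 - k t) ^+ 4).
    by rewrite /E {1}vS vSk expRD; field; rewrite v_neq0 k1n.
  by rewrite ler_pM2l// ler_wpM2r ?expR_ge1Dx// exprn_ge0// subr_ge0 ltW.
have : (1 + d t) * (1 - 4 * k t) <= (1 + d t) * (1 - k t) ^+ 4.
  rewrite ler_wpM2l ?addr_ge0//.
  have := k_ge0 t; have := k_lt1 t; move: (k t) => x x1 x0.
  have : 0 <= x ^+ 2 * (6 - 4 * x + x ^+ 2).
    by rewrite mulr_ge0 ?sqr_ge0//; have := sqr_ge0 x; lra.
  by lra.
move=> /(ler_wpM2l (ltW (E_gt0 t))) /le_trans h /h{}h.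
rewrite -lerBlDr opprK; apply: le_trans h.
rewrite -subr_ge0 (_ : _ - _ = 0) //.
by ring.
Qed.

Let Ediff_cvg : E t.+1 - E t @[t --> \oo] --> L^-1.
Proof.
have Lk : (L * (1 - k t))^-1 @[t --> \oo] --> L^-1.
  apply: cvgV; first exact: lt0r_neq0.
  by rewrite -[X in _ --> X]mulr1; apply: cvgM => //; exact: cvg_cst.
have d1 : 1 - d t @[t --> \oo] --> (1 : R).
  by rewrite -[X in _ --> X]subr0; apply: cvgB => //; exact: cvg_cst.
have lb : (1 - 4 * k t) * (L * (1 - k t))^-1 - 4 / L * u t @[t --> \oo] --> L^-1.
  rewrite [X in _ --> X](_ : _ = (1 - 4 * 0) * L^-1 - 4 / L * 0); last first.
    by rewrite !mulr0 !subr0 mul1r.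
  apply: cvgB; last by apply: cvgM => //; exact: cvg_cst.
  apply: cvgM => //; apply: cvgB; first exact: cvg_cst.
  by apply: cvgM => //; exact: cvg_cst.
have ub : (L * (1 - k t))^-1 / (1 - d t) @[t --> \oo] --> L^-1.
  have := cvgM Lk (cvgV (oner_neq0 R) d1); rewrite invr1 mulr1; exact.
apply: (squeeze_cvgr _ lb ub); near=> t; apply/andP; split.
  apply: le_trans (Ediff_ge t); rewrite lerD2l lerN2 invfM /v invrK mulrA //.
apply: Ediff_le; near: t.
by move/cvgr_lt : d_cvg0; apply.
Unshelve. all: by end_near. Qed.

Let E_cvg : E t / t%:R @[t --> \oo] --> L^-1.
Proof.
have /cesaro := Ediff_cvg.
have -> : arithmetic_mean (fun t => E t.+1 - E t) =
          (fun t => (E t.+1 - E 0%N) / t.+1%:R).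
  by apply/funext => t; rewrite /arithmetic_mean /= [series _]telescopeK mulrC.
(* The mean of the first t+1 increments involves E at t+1, hence the shift; the leftover E_0/(t+1)
   vanishes in the limit. *)
move=> H; rewrite -cvg_shiftS.
have H0 : E 0%N / t.+1%:R @[t --> \oo] --> 0.
  by rewrite -[X in _ --> X](mulr0 (E 0%N)); apply: cvgM; [exact: cvg_cst|exact: cvg_harmonic].
have := cvgD H H0; rewrite addr0 => /(_ _); apply: cvg_near_eq.
by apply: nearW => t /=; rewrite -mulrDl subrK.
Qed.

(** With s = sqrt(u), ln v = 2 ln(1/s) <= 2/s, and multiplying by u = s^2 leaves 2 s. *)
Let lnv_cvg0 : ln (v t) * u t @[t --> \oo] --> 0.
Proof.
have ub : 2 * Num.sqrt (u t) @[t --> \oo] --> 0.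
  have -> : 0 = 2 * Num.sqrt 0 :> R by rewrite sqrtr0 mulr0.
  apply: cvgM; first exact: cvg_cst.
  by apply: continuous_cvg => //; exact: sqrt_continuous.
apply: (squeeze_cvgr _ (cvg_cst 0) ub); near=> t.
rewrite mulr_ge0 ?ln_ge0 ?(ltW (u_gt0 t))//=.
have s0 : 0 < Num.sqrt (u t) by rewrite sqrtr_gt0.
rewrite /v -[X in ln X^-1](sqr_sqrtr (ltW (u_gt0 t))) -exprVn.
rewrite lnXn ?invr_gt0// -[X in _ * X <= _](sqr_sqrtr (ltW (u_gt0 t))).
move: s0; set s := Num.sqrt (u t) => s0.
have -> : 2 * s = s^-1 *+ 2 * s ^+ 2 by field; rewrite gt_eqF.
by rewrite ler_wpM2r ?sqr_ge0// lerMn2r ltW// ln_sublinear// invr_gt0.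
Unshelve. all: by end_near. Qed.

Let tE_cvg : t%:R / E t @[t --> \oo] --> L.
Proof.
have Ln : L^-1 != 0 by rewrite invr_eq0 lt0r_neq0.
have := cvgV Ln E_cvg; rewrite invrK => /(_ _); apply: cvg_near_eq.
by apply: nearW => t /=; rewrite invfM invrK mulrC.
Qed.

(** Write ln t = ln(t/E) + v - 4 ln v and divide by v: the first term converges before division and
    ln v is negligible against v. *)
Let lnt_cvg : ln t%:R / v t @[t --> \oo] --> (1 : R).
Proof.
have lnE : ln (t%:R / E t) @[t --> \oo] --> ln L.
  by apply: (continuous_cvg _ (continuous_ln L0)); exact: tE_cvg.
have : ln (t%:R / E t) * u t + 1 - 4 * (ln (v t) * u t) @[t --> \oo] --> (1 : R).
  rewrite [X in _ --> X](_ : _ = ln L * 0 + 1 - 4 * 0); last first.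
    by rewrite !mulr0 add0r subr0.
  apply: cvgB; last by apply: cvgM => //; exact: cvg_cst.
  by apply: cvgD; [exact: cvgM|exact: cvg_cst].
apply: cvg_near_eq; near=> t.
have t0 : 0 < t%:R :> R by rewrite ltr0n; near: t; exists 1%N.
have -> : ln t%:R = ln (t%:R / E t) + (v t - ln (v t) *+ 4).
  rewrite ln_div ?posrE// /E ln_div ?posrE ?expR_gt0 ?exprn_gt0// expRK lnXn//.
  by rewrite subrK.
have := u_gt0 t => /lt0r_neq0 un.
by rewrite /v; field.
Unshelve. all: by end_near. Qed.

(** The expression equals (t/E) (ln t / v)^4 / L, whose factors converge to L, 1 and 1/L. *)
Lemma expRNV_rate :
  t%:R * ln (t%:R : R) ^+ 4 / L * expR (- (u t)^-1) @[t --> \oo] --> (1 : R).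
Proof.
have X4 : (ln t%:R / v t) ^+ 4 @[t --> \oo] --> (1 : R) ^+ 4.
  exact: (continuous_cvg _ (@exprn_continuous R 4 1) lnt_cvg).
have := cvgM (cvgM tE_cvg X4) (cvg_cst L^-1).
rewrite expr1n mulr1 divff ?lt0r_neq0//.
move=> /(_ _ _ _); apply: cvg_near_eq; apply: nearW => t /=.
rewrite -/(v t) /E expRN; have := v_neq0 t => vt; move: (lt0r_neq0 L0) => Ln.
by field; rewrite vt Ln (gt_eqF (expR_gt0 _)).
Qed.

End Rate.

(** * Frank--Wolfe iterates *)

Lemma ln_le_powR (R : realType) (c x : R) : 0 < c -> 0 < x -> ln x <= x `^ c / c.
Proof.
move=> c0 x0; rewrite ler_pdivlMr// mulrC -ln_powR ltW// ln_sublinear//.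
exact: powR_gt0.
Qed.

Lemma near_ln_nat_ge (R : realType) (A : R) : \forall t \near \oo, A <= ln (t%:R : R).
Proof.
near=> t; have tA : expR A <= t%:R :> R by near: t; exact: nbhs_infty_ger.
by rewrite -[A]expRK ler_ln ?posrE ?expR_gt0// (lt_le_trans (expR_gt0 A)).
Unshelve. all: by end_near. Qed.

(** * Landau comparisons deduced from the limit *)

Section RateLandau.
Variables (R : realType) (L : R) (y : nat -> R).
Hypothesis L0 : 0 < L.
Hypothesis rate : t%:R * ln (t%:R : R) ^+ 4 / L * y t @[t --> \oo] --> (1 : R).

Let near_ln_gt0 : \forall t \near \oo, 0 < (t%:R : R) /\ 0 < ln (t%:R : R).
Proof.
near=> t; split; first by rewrite ltr0n; near: t; exists 1%N.
by apply: lt_le_trans ltr01 _; near: t; exact: near_ln_nat_ge.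
Unshelve. all: by end_near. Qed.

Lemma rate_equiv : y ~_\oo (fun t : nat => L / (t%:R * ln (t%:R : R) ^+ 4)).
Proof.
apply/eqaddoP => e e0; near=> t.
have [t0 l0] : 0 < (t%:R : R) /\ 0 < ln (t%:R : R) by near: t; exact: near_ln_gt0.
have w0 : 0 < t%:R * ln t%:R ^+ 4 / L by rewrite divr_gt0 ?mulr_gt0 ?exprn_gt0.
have gw : L / (t%:R * ln t%:R ^+ 4) = (t%:R * ln t%:R ^+ 4 / L)^-1 by rewrite invf_div.
rewrite [X in `|X| <= _](_ : _ = y t - (t%:R * ln t%:R ^+ 4 / L)^-1);
  last by rewrite -gw.
rewrite gw; set w := t%:R * _ / L in w0 *.
rewrite [`|w^-1|]gtr0_norm ?invr_gt0// ler_pdivlMr// -[X in _ * X <= _](gtr0_norm w0).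
rewrite -normrM mulrBl mulVf ?gt_eqF// [y t * w]mulrC distrC /w.
by near: t; move/cvgrPdist_le : rate; apply.
Unshelve. all: by end_near. Qed.

Lemma rate_littleo : y =o_\oo (fun t : nat => (t%:R : R)^-1).
Proof.
apply/eqoP => e e0; near=> t.
have [t0 l0] : 0 < (t%:R : R) /\ 0 < ln (t%:R : R) by near: t; exact: near_ln_gt0.
rewrite [`|_^-1|]gtr0_norm ?invr_gt0// ler_pdivlMr//.
have : `|t%:R * ln t%:R ^+ 4 / L * y t| <= 2.
  have : `|1 - t%:R * ln t%:R ^+ 4 / L * y t| <= 1.
    by near: t; move/cvgrPdist_le : rate; apply.
  by rewrite !ler_norml => /andP[? ?]; apply/andP; split; lra.
have l1 : 1 <= ln t%:R :> R by near: t; exact: near_ln_nat_ge.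
(* With l = ln t, this threshold gives t |y| <= 2 L / l^4 <= 2 L / l <= e. *)
have : 2 * L / e <= ln t%:R by near: t; exact: near_ln_nat_ge.
rewrite ler_pdivrMr// normrM gtr0_norm; last by rewrite divr_gt0 ?mulr_gt0 ?exprn_gt0.
move: t0 l0 l1 (normr_ge0 (y t)); move: `|y t| (t%:R : R) (ln t%:R : R) => Y T l.
move=> t0 l0 l1 Y0 le; rewrite mulrAC ler_pdivrMr// => h.
have l4 : l <= l ^+ 4 by rewrite ler_eXnr.
rewrite -(ler_pM2r (exprn_gt0 4 l0)).
have : l * e <= l ^+ 4 * e by rewrite ler_pM2r.
move: h le; rewrite mulrAC [T * Y]mulrC [e * _]mulrC; lra.
Unshelve. all: by end_near. Qed.

Lemma rate_not_bigO (eta : R) : 0 < eta ->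
  ~ (y =O_\oo (fun t : nat => (t%:R : R) `^ (- 1 - eta))).
Proof.
move=> eta0 /eqO_exP[K K0 yK].
(* Put P = t^c, so that t^eta = P^8. The bound ln t <= P/c spends four of these eight factors on (ln
   t)^4, and the remaining P^4 exceeds [Q], which contradicts 1/2 <= (Q/2) / P^4. *)
pose c := eta / 8; have c0 : 0 < c by rewrite divr_gt0.
pose Q := 2 * K / (L * c ^+ 4).
suff : \forall t \near \oo, (False : Prop).
  by move=> [n _ /(_ n (leqnn n))].
near=> t.
have [t0 l0] : 0 < (t%:R : R) /\ 0 < ln (t%:R : R) by near: t; exact: near_ln_gt0.
have wy : 1 / 2 <= t%:R * ln t%:R ^+ 4 / L * y t.
  have : `|1 - t%:R * ln t%:R ^+ 4 / L * y t| <= 1 / 2.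
    by near: t; move/cvgrPdist_le : rate; apply; rewrite divr_gt0.
  by rewrite ler_norml => /andP[_]; lra.
have yt : `|y t| <= K * `|t%:R `^ (- 1 - eta)| by near: t.
have P0 : 0 < (t%:R : R) `^ c := powR_gt0 _ t0.
have lP := ln_le_powR c0 t0.
have QP : 1 + Q <= (t%:R : R) `^ c.
  have : (1 + Q) / c <= ln t%:R by near: t; exact: near_ln_nat_ge.
  by move=> /le_trans/(_ lP); rewrite ler_pM2r ?invr_gt0.
have tE : (t%:R : R) `^ (- 1 - eta) = (t%:R * (t%:R `^ c) ^+ 8)^-1.
  rewrite -opprD powRN powRD ?powRr1 ?(ltW t0)//; last by rewrite (gt_eqF t0) implybT.
  congr (_ * _)^-1; rewrite -powR_mulrn ?powR_ge0// -powRrM.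
  by congr (_ `^ _); rewrite /c divfK.
move: yt; rewrite tE [X in _ <= _ * X]gtr0_norm ?invr_gt0 ?mulr_gt0 ?exprn_gt0// => yt.
have {}yt := le_trans (ler_norm _) yt.
have w0 : 0 < t%:R * ln t%:R ^+ 4 / L by rewrite divr_gt0 ?mulr_gt0 ?exprn_gt0.
have := le_trans wy (ler_wpM2l (ltW w0) yt).
have Q0 : 0 <= Q by rewrite divr_ge0 ?mulr_ge0 ?exprn_ge0 ?ltW.
move: P0 lP QP l0 t0; move: (t%:R : R) (ln (t%:R : R)) (t%:R `^ c) => T l P.
move=> P0 lP QP l0 T0.
have -> : T * l ^+ 4 / L * (K / (T * P ^+ 8)) = K / L * l ^+ 4 / P ^+ 8.
  by field; rewrite !gt_eqF.
have l4 : l ^+ 4 <= P ^+ 4 / c ^+ 4.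
  by rewrite -expr_div_n; apply: lerXn2r => //; rewrite nnegrE ?divr_ge0 ?ltW.
rewrite leNgt => /negP; apply; apply: (@le_lt_trans _ _ (Q / 2 / P ^+ 4)).
  rewrite ler_pdivrMr ?exprn_gt0//.
  have -> : Q / 2 / P ^+ 4 * P ^+ 8 = K / L * (P ^+ 4 / c ^+ 4).
    by rewrite /Q; field; rewrite !gt_eqF.
  by rewrite ler_wpM2l// divr_ge0 ?ltW.
rewrite ltr_pdivrMr ?exprn_gt0//.
have : P <= P ^+ 4 by rewrite ler_eXnr//; lra.
by lra.
Unshelve. all: by end_near. Qed.

End RateLandau.

(** * Reduction of the iterates to the scalar recursion *)

Section FrankWolfe.
Variables (R : realType) (a L : R) (S : 'rV[R]_2 -> 'rV[R]_2).
Hypothesis a0 : 0 < a.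
Hypothesis L0 : 0 < L.
Hypothesis lip : L.-lipschitz (dphi a).
Hypothesis HS : lmo_selector (@unit_ball R 2) S.

Lemma grad_objective x : grad (objective a) x = - dphi a (1 - x 0 0) *: e1 R.
Proof. exact: (grad_ridge 0 (fun u => is_derive_phi u a0)). Qed.

Lemma fw_step_e1 w : 0 < w <= a ->
  fw_step (objective a) S L ((1 - w) *: e1 R) = (1 - (w - dphi a w / L)) *: e1 R.
Proof.
move=> wa; have /andP[w0 _] := wa.
have c0 : 0 < dphi a w by rewrite dphiE// divr_gt0 ?expR_gt0 ?exprn_gt0.
have cL := dphi_lt_linear L0 lip wa.
rewrite /fw_step grad_objective (_ : 1 - ((1 - w) *: e1 R) 0 0 = w); last first.
  by rewrite !mxE/= mulr1 subKr.
set c := dphi a w in c0 cL *.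
(* As c > 0, the minimizer over the ball is unique, so every selector returns e1. *)
have -> : S (- c *: e1 R) = e1 R.
  have := lmo_unit_ball (- c *: e1 R) HS.
  rewrite enormZ normrN (gtr0_norm c0) enorm_e1 mulr1 -scaleNr opprK.
  by apply: scalerI; rewrite gt_eqF.
have -> : (1 - w) *: e1 R - e1 R = - w *: e1 R.
  by rewrite -[X in _ - X]scale1r -scalerBl addrAC subrr add0r.
have -> : e1 R - (1 - w) *: e1 R = w *: e1 R.
  by rewrite -[X in X - _]scale1r -scalerBl subKr.
rewrite enormZ normrN (gtr0_norm w0) enorm_e1 mulr1.
rewrite dotZl dotZr -enorm_sqr enorm_e1 expr1n mulr1 mulrNN.
have -> : c * w / (L * w ^+ 2) = c / (L * w) by field; rewrite !gt_eqF.
rewrite min_l; last by rewrite ler_pdivrMr ?mulr_gt0// mul1r ltW.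
by rewrite scalerA -scalerDl; congr (_ *: _); field; rewrite !gt_eqF.
Qed.

Variable u0 : R.
Hypothesis hu0 : 0 < u0 <= a.

Let u t := iter t (fun w => w - dphi a w / L) u0.

(** The inequality that excludes clipping gives positivity, and [dphi] >= 0 keeps the iterate below
    [a], so the exponential branch of [phi] applies at every step. *)
Let u_bounds t : 0 < u t <= a.
Proof.
elim: t => [//|t ut]; have /andP[ut0 uta] := ut.
have := dphi_lt_linear L0 lip ut; rewrite mulrC -ltr_pdivrMr// => h.
rewrite /u/= -/(u t) subr_gt0 h/= (le_trans _ uta)// gerBl.
by rewrite divr_ge0 ?dphi_ge0 ?ltW.
Qed.

Let fw_iteratesE t :
  fw_iterates (objective a) S L ((1 - u0) *: e1 R) t = (1 - u t) *: e1 R.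
Proof.
elim: t => [//|t IH]; rewrite /fw_iterates iterS -/(fw_iterates _ _ _ _ _) IH.
by rewrite fw_step_e1// u_bounds.
Qed.

Lemma fw_rate : a <= 1 ->
  t%:R * ln (t%:R : R) ^+ 4 / L *
    (objective a (fw_iterates (objective a) S L ((1 - u0) *: e1 R) t) -
     objective a (e1 R)) @[t --> \oo] --> (1 : R).
Proof.
move=> a1.
have := @expRNV_rate R L u L0.
have ug0 t : 0 < u t by have /andP[] := u_bounds t.
move=> /(_ ug0) H.
have : t%:R * ln (t%:R : R) ^+ 4 / L * expR (- (u t)^-1) @[t --> \oo] --> (1 : R).
  apply: H => t; first by have /andP[_ /le_trans] := u_bounds t; apply.
  by rewrite /u /= -/(u t) dphiE// u_bounds.
apply: cvg_near_eq; apply: nearW => t.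
have -> : objective a (e1 R) = 0 by rewrite -[e1 R]scale1r objective_e1 subrr phi0.
by rewrite fw_iteratesE objective_e1 subr0 subKr phiE// u_bounds.
Qed.

End FrankWolfe.

Theorem propositionA5 (R : realType) (a Lhat u0 : R)
    (S : 'rV[R]_2 -> 'rV[R]_2)
    (ha : 0 < a < 1 / 2)
    (hL : 0 < Lhat) (hLip : Lhat.-lipschitz ((phi a)^`())%classic)
    (hS : lmo_selector (@unit_ball R 2) S)
    (hu0 : 0 < u0 < a) :
  let C := @unit_ball R 2 in
  let p := e1 R in
  let f := objective a in
  let x_ := fw_iterates f S Lhat ((1 - u0) *: e1 R) in
  [/\ global_local_dual_sharpness C S (1 / 2) 2,
      [/\ convex_function setT f, smooth_on C Lhat f & argmin C f = [set p]],
      forall r : R, 2 <= r -> ~ local_holder_error_bound C f r &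
      [/\ t%:R * ln (t%:R : R) ^+ 4 / Lhat * (f (x_ t) - f p) @[t --> \oo]
            --> (1 : R),
          (fun t : nat => f (x_ t) - f p) ~_\oo
            (fun t : nat => Lhat / (t%:R * ln (t%:R : R) ^+ 4)),
          (fun t : nat => f (x_ t) - f p) =o_\oo
            (fun t : nat => (t%:R : R)^-1) &
          forall eta : R, 0 < eta ->
            ~ ((fun t : nat => f (x_ t) - f p) =O_\oo
                 (fun t : nat => (t%:R : R) `^ (- 1 - eta)))]].
Proof.
move=> C p f x_; have /andP[a0 a2] := ha.
have /andP[u00 u0a] := hu0.
have hd (u : R) : is_derive u 1 (phi a) (dphi a u) := is_derive_phi u a0.
rewrite derive1_phi// in hLip.
have rate : t%:R * ln (t%:R : R) ^+ 4 / Lhat * (f (x_ t) - f p) @[t --> \oo] --> (1 : R).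
  by apply: fw_rate => //; [rewrite u00 ltW|lra].
split.
- exact: unit_ball_sharpness.
- split; last exact: argmin_objective.
  + exact: (convex_ridge 0 hd (dphi_nondecreasing ha)).
  + apply: (smooth_on_ridge 0 hd C (ltW hL)) => u w uw.
    exact: dphi_lipschitz_le.
- by move=> r r2; apply: no_local_holder_error_bound => //; lra.
- split=> //; first exact: rate_equiv.
  + exact: (rate_littleo hL rate).
  + by move=> eta eta0; exact: (rate_not_bigO hL rate eta0).
Qed.
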